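(* For all integers $m,n\ge 1$, the toric ideal $I_{K_{m,n}}$ of the complete bipartite graph $K_{m,n}$ is not subgraph splittable.
   Context: Let $K$ be any field. For a finite simple graph $G$ with vertices $v_1,\dots,v_p$ and edge set $E(G)=\{e_1,\dots,e_q\}$, the edges are also used as variables of the polynomial ring $K[e_1,\dots,e_q]$, and the toric ideal $I_G\subset K[e_1,\dots,e_q]$ is the kernel of the $K$-algebra map $K[e_1,\dots,e_q]\to K[v_1,\dots,v_p]$ sending an edge $e=\{v_i,v_j\}$ to $v_iv_j$. For a subgraph $H$ of $G$ (not necessarily connected), $I_H$ is defined in the same way in the variables $E(H)$ and is regarded as the ideal it generates in $K[e_1,\dots,e_q]$. A subgraph splitting of $I_G$ is an equality $I_G=I_{G_1}+I_{G_2}$ with $G_1,G_2$ subgraphs of $G$, $I_{G_1}\neq I_G$ and $I_{G_2}\neq I_G$. $I_G$ is subgraph splittable if it has a subgraph splitting. $K_{m,n}$ is the graph whose vertex set is the disjoint union of sets $V_1,V_2$ with $m$ and $n$ elements, whose edges are exactly the pairs $\{x,y\}$ with $x\in V_1$, $y\in V_2$. *)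

(* Defs.v *)
From HB Require Import structures.
From mathcomp Require Import all_boot all_order all_algebra.
From mathcomp Require Import mpoly.

Set Implicit Arguments.
Unset Strict Implicit.
Unset Printing Implicit Defensive.

Import GRing.Theory.
Local Open Scope ring_scope.

(* Finite simple graphs whose vertices are taken from an ambient finite type;
   an edge is the two-element set of its end points. *)
Record graph (T : finType) := Graph {
  verts : {set T};
  edges : {set {set T}};
  edge_verts : forall e, e \in edges -> e \subset verts;
  edge_card2 : forall e, e \in edges -> #|e| = 2%N
}.

Record subgraph (T : finType) (H G : graph T) : Prop := Subgraph {
  sub_verts : verts H \subset verts G;
  sub_edges : edges H \subset edges G
}.

Section Ideals.
Variable R : comNzRingType.

Definition generated_ideal (S : R -> Prop) (f : R) : Prop :=
  exists (k : nat) (a g : 'I_k -> R),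
    (forall i, S (g i)) /\ f = \sum_(i < k) a i * g i.

Definition ideal_sum (I J : R -> Prop) (f : R) : Prop :=
  exists a b : R, [/\ I a, J b & f = a + b].

Definition ideal_eq (I J : R -> Prop) : Prop := forall f, I f <-> J f.

End Ideals.

Section ToricIdeals.
Variables (K : fieldType) (T : finType).
Implicit Types G H : graph T.

(* The i-th variable stands for the i-th edge (resp. vertex) in the
   enumeration of [edges G] (resp. [verts G]). *)
Definition edge_ring G := {mpoly K[#|edges G|]}.
Definition vert_ring G := {mpoly K[#|verts G|]}.

(* The product of the two variables of the end points of the i-th edge. *)
Definition edge_monomial G (i : 'I_#|edges G|) : vert_ring G :=
  \prod_(v < #|verts G| | enum_val v \in enum_val i) 'X_v.

Definition toric_map G (f : edge_ring G) : vert_ring G :=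
  f \mPo [tuple edge_monomial i | i < #|edges G|].

Definition toric_ideal G (f : edge_ring G) : Prop := toric_map f = 0.

Definition edge_incl H G (s : subgraph H G) (i : 'I_#|edges H|) :
    'I_#|edges G| :=
  enum_rank_in (subsetP (sub_edges s) _ (enum_valP i)) (enum_val i).

Definition edge_ring_incl H G (s : subgraph H G) (f : edge_ring H) :
    edge_ring G :=
  f \mPo [tuple 'X_(edge_incl s i) | i < #|edges H|].

Definition toric_ideal_in H G (s : subgraph H G) : edge_ring G -> Prop :=
  generated_ideal
    (fun f => exists2 g : edge_ring H, toric_ideal g & f = edge_ring_incl s g).

Definition subgraph_splitting G G1 G2
    (s1 : subgraph G1 G) (s2 : subgraph G2 G) : Prop :=
  [/\ ideal_eq (@toric_ideal G)
        (ideal_sum (toric_ideal_in s1) (toric_ideal_in s2)),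
      ~ ideal_eq (toric_ideal_in s1) (@toric_ideal G)
    & ~ ideal_eq (toric_ideal_in s2) (@toric_ideal G)].

Definition subgraph_splittable G : Prop :=
  exists (G1 G2 : graph T) (s1 : subgraph G1 G) (s2 : subgraph G2 G),
    subgraph_splitting s1 s2.

End ToricIdeals.

Section CompleteBipartite.
Variables m n : nat.

Definition Kmn_edges : {set {set 'I_m + 'I_n}} :=
  [set [set inl i; inr j] | i in 'I_m, j in 'I_n].

Lemma Kmn_edge_verts e : e \in Kmn_edges -> e \subset [set: 'I_m + 'I_n].
Proof. by move=> _; exact: subsetT. Qed.

Lemma Kmn_edge_card2 e : e \in Kmn_edges -> #|e| = 2%N.
Proof. by case/imset2P=> i j _ _ ->; rewrite cards2. Qed.

Definition complete_bipartite : graph ('I_m + 'I_n)%type :=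
  Graph Kmn_edge_verts Kmn_edge_card2.

End CompleteBipartite.

(* Main.v *)
Require Import Defs.
From mathcomp Require Import all_boot all_order all_algebra.
From mathcomp Require Import mpoly.

(** The ideal of the complete bipartite graph is governed by its 4-cycles.  If
    m = 1 or n = 1 the graph is a star: its edge monomials are algebraically
    independent, the toric ideal is zero and nothing smaller exists.  Otherwise
    suppose that I_G = I_{G1} + I_{G2} with both summands proper.  A subgraph
    with all edges of G has the same toric ideal as G, so G1 misses some edge
    ab and G2 misses some edge cd (a, c on the left side, b, d on the right).
    Any two edges of a complete bipartite graph with m, n >= 2 lie on a common
    4-cycle; let q be the binomial of a 4-cycle C through ab and cd, which
    belongs to I_G.

    Both I_{G1} and I_{G2} vanish at a point where q does not.  The point takes
    the value 1 at the edges of C other than ad and the value 0 elsewhere, so q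
    takes a value 1 - 0 there, up to sign.  An ideal I_H vanishes at every point
    whose coordinates on the edges xy of H have the form w(x) w(y) for a
    weighting w of the vertices ([toric_ideal_in_meval]).  The edge ad equals or
    is adjacent to each of the missing edges ab and cd.  If ad itself is missing
    from H, the weighting is the indicator of the vertices of C; if a neighbour
    of ad on C is missing, then ad is an end edge of the path that remains of C,
    and the weighting is 1 on C except at the end of ad that lies on no other edge
    of that path, and 0 at that end and off C
    ([toric_ideal_in_path_point]). *)

Set Implicit Arguments.
Unset Strict Implicit.
Unset Printing Implicit Defensive.

Import GRing.Theory.
Local Open Scope ring_scope.

(** * Points and substitutions that kill toric ideals *)

Lemma comp_mpolyA (R : comNzRingType) n k l (lq : n.-tuple {mpoly R[k]})
    (lr : k.-tuple {mpoly R[l]}) (p : {mpoly R[n]}) :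
  (p \mPo lq) \mPo lr = p \mPo [tuple tnth lq i \mPo lr | i < n].
Proof.
rewrite [p \mPo lq]comp_mpolyEX [RHS]comp_mpolyEX raddf_sum /=.
apply: eq_bigr => M _; rewrite comp_mpolyZ; congr (_ *: _).
rewrite !comp_mpolyX rmorph_prod /=; apply: eq_bigr => i _.
by rewrite rmorphXn tnth_mktuple.
Qed.

Section ToricIdeals.
Variables (K : fieldType) (T : finType).
Implicit Types G H : graph T.

Lemma prod_enum_verts (A : comNzRingType) G (w : T -> A) (e : {set T}) :
  e \subset verts G ->
  \prod_(v < #|verts G| | enum_val v \in e) w (enum_val v) = \prod_(x in e) w x.
Proof.
move=> sub; rewrite -(big_enum_val_cond (fun x => x \in e) w).
apply: eq_bigl => x; case: (boolP (x \in e)) => xe; rewrite ?andbF //.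
by rewrite (subsetP sub).
Qed.

Lemma meval_edge_monomial G (w : T -> K) (i : 'I_#|edges G|) :
  (edge_monomial K i).@[fun v => w (enum_val v)] = \prod_(x in enum_val i) w x.
Proof.
rewrite rmorph_prod -(@prod_enum_verts _ G); last exact/edge_verts/enum_valP.
by apply: eq_bigr => v _; exact: mevalXU.
Qed.

(** The points whose edge coordinates are products of vertex weights form the
    parametrized part of the toric variety. *)
Lemma toric_ideal_meval G (w : T -> K) (f : edge_ring K G) :
  toric_ideal f ->
  f.@[fun i : 'I_#|edges G| => \prod_(x in enum_val i) w x] = 0.
Proof.
move=> f0; have := congr1 (meval (fun v => w (enum_val v))) f0.
rewrite /toric_map comp_mpoly_meval meval0 => <-; apply: meval_eq => i.
by rewrite tnth_mktuple meval_edge_monomial.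
Qed.

(** Only the coordinates at edges of [H] matter, so a point off the toric
    variety of [G] can still kill the ideal of [H]. *)
Lemma toric_ideal_in_meval H G (s : subgraph H G) (P : {set T} -> K)
    (w : T -> K) (f : edge_ring K G) :
  (forall e, e \in edges H -> P e = \prod_(x in e) w x) ->
  toric_ideal_in s f -> f.@[fun i : 'I_#|edges G| => P (enum_val i)] = 0.
Proof.
move=> Pw [k [a [g [gI ->]]]]; rewrite rmorph_sum big1 // => t _ /=.
rewrite mevalM; have [h hI ->] := gI t.
rewrite comp_mpoly_meval.
rewrite -[X in _ * X = _](_ :
    h.@[fun i : 'I_#|edges H| => \prod_(x in enum_val i) w x] = _).
  by rewrite toric_ideal_meval ?mulr0.
apply: meval_eq => i; rewrite tnth_mktuple mevalXU /edge_incl enum_rankK_in.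
  by rewrite Pw ?enum_valP.
exact: (subsetP (sub_edges s)) (enum_valP i).
Qed.

(** The vertex substitution [w] provides a left inverse of the toric map. *)
Lemma toric_ideal_eq0 G (w : T -> edge_ring K G) (f : edge_ring K G) :
  (forall i : 'I_#|edges G|, \prod_(x in enum_val i) w x = 'X_i) ->
  toric_ideal f -> f = 0.
Proof.
move=> wX f0; pose lw := [tuple w (enum_val v) | v < #|verts G|].
have := congr1 (comp_mpoly lw) f0.
rewrite /toric_map comp_mpolyA comp_mpoly0 => <-.
rewrite -[LHS]comp_mpoly_id; congr (_ \mPo _); apply: eq_mktuple => i.
rewrite tnth_mktuple -wX rmorph_prod.
rewrite -(@prod_enum_verts _ G); last exact/edge_verts/enum_valP.
by apply: eq_bigr => v _; rewrite /= comp_mpolyXU -tnth_nth tnth_mktuple.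
Qed.

Lemma toric_ideal_in0 H G (s : subgraph H G) : toric_ideal_in (K := K) s 0.
Proof.
by exists 0%N, (fun=> 0), (fun=> 0); split=> [[]|] //; rewrite big_ord0.
Qed.

Lemma toric_ideal_in_full H G (s : subgraph H G) (f : edge_ring K G) :
  verts H = verts G -> edges H = edges G ->
  toric_ideal f -> toric_ideal_in s f.
Proof.
(* The two graphs may still differ in the proofs they carry, which the toric
   map does not see; the inclusion of edge rings becomes the identity. *)
case: H s => V E p1 p2 s /= eV eE.
case: G s f eV eE => V' E' q1 q2 s f /= eV eE; subst V' E' => f0.
exists 1%N, (fun=> 1), (fun=> f); split; last by rewrite big_ord1 mul1r.
move=> _; exists f => //; rewrite /edge_ring_incl -[LHS]comp_mpoly_id.
congr (_ \mPo _); apply: eq_mktuple => i; congr 'X_ _.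
by rewrite /edge_incl enum_valK_in.
Qed.

End ToricIdeals.

(** * Complete bipartite graphs *)

Section CompleteBipartite.
Variables (K : fieldType) (m n : nat).
Local Notation G := (complete_bipartite m n).
Local Notation edge i j := ([set inl i; inr j] : {set 'I_m + 'I_n}).

Lemma edge_in_Kmn i j : edge i j \in edges G.
Proof. exact: imset2_f. Qed.

Lemma big_edge (A : comNzRingType) (w : 'I_m + 'I_n -> A) i j :
  \prod_(x in edge i j) w x = w (inl i) * w (inr j).
Proof. by rewrite big_setU1 ?big_set1 // inE. Qed.

Lemma edge_inj i j k l : edge i j = edge k l -> i = k /\ j = l.
Proof.
move=> eE; split.
  have : inl i \in edge k l by rewrite -eE !inE eqxx.
  by rewrite !inE orbF => /eqP[].
have : inr j \in edge k l by rewrite -eE !inE eqxx orbT.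
by rewrite !inE => /eqP[].
Qed.

Definition edge_index i j : 'I_#|edges G| :=
  enum_rank_in (edge_in_Kmn i j) (edge i j).

Lemma edge_indexK i j : enum_val (edge_index i j) = edge i j.
Proof. exact: enum_rankK_in (edge_in_Kmn i j). Qed.

Lemma edge_index_ex (t : 'I_#|edges G|) : exists i j, t = edge_index i j.
Proof.
have /imset2P[i j _ _ e] := enum_valP t; exists i, j.
by apply: enum_val_inj; rewrite edge_indexK.
Qed.

Lemma toric_ideal_star (i0 : 'I_m) (j0 : 'I_n) (f : edge_ring K G) :
  m = 1%N \/ n = 1%N -> toric_ideal f -> f = 0.
Proof.
(* The centre of the star becomes 1, each leaf becomes its edge. *)
case=> [m1|n1].
- refine (@toric_ideal_eq0 K _ G
    (fun x => if x is inr j then 'X_(edge_index i0 j) else 1) f _) => t.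
  have [i [j ->]] := edge_index_ex t.
  rewrite edge_indexK big_edge mul1r (_ : i0 = i) //.
  by apply: ord_inj; move: i0 i => [] + + []; rewrite m1 => -[|?] // ? [|?].
- refine (@toric_ideal_eq0 K _ G
    (fun x => if x is inl i then 'X_(edge_index i j0) else 1) f _) => t.
  have [i [j ->]] := edge_index_ex t.
  rewrite edge_indexK big_edge mulr1 (_ : j0 = j) //.
  by apply: ord_inj; move: j0 j => [] + + []; rewrite n1 => -[|?] // ? [|?].
Qed.

Lemma toric_ideal_4cycle i k j l :
  toric_ideal ('X_(edge_index i j) * 'X_(edge_index k l)
     - 'X_(edge_index i l) * 'X_(edge_index k j) : edge_ring K G).
Proof.
pose X x : vert_ring K G := 'X_(enum_rank_in (in_setT (inl i)) x).
have XE a b : 'X_(edge_index a b) \mPo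
    [tuple edge_monomial K t | t < #|edges G|] = X (inl a) * X (inr b).
  rewrite comp_mpolyXU -tnth_nth tnth_mktuple /edge_monomial edge_indexK.
  rewrite -big_edge -(@prod_enum_verts _ _ G); last exact: subsetT.
  by apply: eq_bigr => v _; rewrite /X enum_valK_in.
rewrite /toric_ideal /toric_map comp_mpolyB !rmorphM /= !XE.
by rewrite mulrACA [X (inr j) * _]mulrC mulrACA subrr.
Qed.

Lemma full_subgraph_verts H (s : subgraph H G) (i0 : 'I_m) (j0 : 'I_n) :
  edges H = edges G -> verts H = verts G.
Proof.
move=> eE; apply/eqP; rewrite eqEsubset sub_verts //=; apply/subsetP => x _.
case: x => [i|j].
  have /edge_verts/subsetP : edge i j0 \in edges H by rewrite eE edge_in_Kmn.
  by apply; rewrite !inE eqxx.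
have /edge_verts/subsetP : edge i0 j \in edges H by rewrite eE edge_in_Kmn.
by apply; rewrite !inE eqxx.
Qed.

Lemma proper_toric_ideal_missing_edge H (s : subgraph H G)
    (i0 : 'I_m) (j0 : 'I_n) :
  (forall f, toric_ideal_in s f -> @toric_ideal K _ G f) ->
  ~ ideal_eq (toric_ideal_in s) (@toric_ideal K _ G) ->
  exists i j, edge i j \notin edges H.
Proof.
move=> sub neq; have [full|] := boolP (edges G \subset edges H).
  have eE : edges H = edges G by apply/eqP; rewrite eqEsubset sub_edges.
  case: neq => f; split; first exact: sub.
  exact: toric_ideal_in_full (full_subgraph_verts s i0 j0 eE) eE.
by case/subsetPn => _ /imset2P[i j _ _ ->] ijH; exists i, j.
Qed.

(** This is the separating point: the three edges left of the 4-cycle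
    [a d a' d'] without [ad] contain only one of the two matchings that the
    binomial of the cycle compares.  It is defined on arbitrary vertex sets so that the
    same point serves for [G] and its subgraphs. *)
Definition path_point (a a' : 'I_m) (d d' : 'I_n) (e : {set 'I_m + 'I_n}) : K :=
  ((e \subset [set inl a; inl a'; inr d; inr d']) && (e != edge a d))%:R.

Lemma path_pointE a a' d d' i j :
  path_point a a' d d' (edge i j) =
  ([&& (i == a) || (i == a'), (j == d) || (j == d')
     & ~~ ((i == a) && (j == d))])%:R.
Proof.
rewrite /path_point subUset !sub1set !inE /= !orbF -andbA.
congr ([&& _, _ & ~~ _])%:R.
by apply/eqP/andP => [/edge_inj[-> ->]|[/eqP-> /eqP->]].
Qed.

(** The missing edge [cb] is [ad] or one of its two neighbours [ad'], [a'd] on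
    the cycle.  If it is [ad], all other edges of the cycle get the value 1 from
    the indicator of the cycle; if it is [ad'], the vertex [a] hangs on [d]
    alone, so that giving it the weight 0 affects the edge [ad] only, and
    likewise for [a'd] and the vertex [d]. *)
Lemma toric_ideal_in_path_point H (s : subgraph H G) a a' d d' c b
    (f : edge_ring K G) :
  edge c b \notin edges H ->
  (c = a /\ (b = d \/ b = d')) \/ (b = d /\ (c = a \/ c = a')) ->
  toric_ideal_in s f ->
  f.@[fun t : 'I_#|edges G| => path_point a a' d d' (enum_val t)] = 0.
Proof.
move=> cbH cbC.
pose w (x : 'I_m + 'I_n) : K := match x with
  | inl i => if i == a then b == d else i == a'
  | inr j => if j == d then c == a else j == d'
  end%:R.
apply: (@toric_ideal_in_meval _ _ _ _ s _ w) => e eH.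
have /imset2P[i j _ _ eE] := subsetP (sub_edges s) _ eH.
rewrite eE path_pointE big_edge /w -natrM mulnb; congr (nat_of_bool _)%:R.
have : (i == c) && (j == b) = false.
  by apply: contraNF cbH => /andP[/eqP<- /eqP<-]; rewrite -eE.
case: cbC => -[-> [] ->]; rewrite ?eqxx;
  by case: (eqVneq i a) => [->|?]; case: (eqVneq j d) => [->|?];
     rewrite ?eqxx ?andbT ?andbF //=; do ?case: eqVneq => ? //; subst;
     rewrite ?eqxx.
Qed.

End CompleteBipartite.

Lemma ord_other p (x y : 'I_p) :
  p <> 1%N -> exists z, z != x /\ (y = x \/ y = z).
Proof.
move=> p1; have [-> {y}|yx] := eqVneq y x; last by exists y; split=> //; right.
have [z zx|all_x] := pickP (predC1 x); first by exists z; split=> //; left.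
case: p1; rewrite -[p]card_ord -(card1 x); apply: eq_card => z.
by rewrite inE; have /negbFE := all_x z.
Qed.

Theorem corollary2p12 (K : fieldType) (m n : nat) (hm : (1 <= m)%N) (hn : (1 <= n)%N) :
  ~ subgraph_splittable K (complete_bipartite m n).
Proof.
pose i0 := Ordinal hm; pose j0 := Ordinal hn.
case=> G1 [G2 [s1 [s2 [split12 neq1 neq2]]]].
have sub1 (f : edge_ring K (complete_bipartite m n)) :
    toric_ideal_in s1 f -> toric_ideal f.
  move=> fI; apply/split12; exists f, 0; rewrite addr0.
  by split=> //; exact: toric_ideal_in0.
have sub2 (f : edge_ring K (complete_bipartite m n)) :
    toric_ideal_in s2 f -> toric_ideal f.
  move=> fI; apply/split12; exists 0, f; rewrite add0r.
  by split=> //; exact: toric_ideal_in0.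
have nstar : ~ (m = 1%N \/ n = 1%N).
  move=> star; case: neq1 => f; split; first exact: sub1.
  by move/(toric_ideal_star i0 j0 star) => ->; apply: toric_ideal_in0.
have [a [b abG1]] := proper_toric_ideal_missing_edge i0 j0 sub1 neq1.
have [c [d cdG2]] := proper_toric_ideal_missing_edge i0 j0 sub2 neq2.
have [a' [a'a ca]] := ord_other a c (fun m1 => nstar (or_introl m1)).
have [d' [d'd bd]] := ord_other d b (fun n1 => nstar (or_intror n1)).
(* The binomial of the 4-cycle through ab, cd and ad. *)
have [q1 [q2 [q1I q2I qE]]] :=
  (split12 _).1 (toric_ideal_4cycle K a' a d' d).
pose ev (f : edge_ring K (complete_bipartite m n)) :=
  f.@[fun t : 'I_#|edges (complete_bipartite m n)| =>
        path_point K a a' d d' (enum_val t)].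
have q10 : ev q1 = 0 by apply: toric_ideal_in_path_point abG1 _ q1I; left.
have q20 : ev q2 = 0 by apply: toric_ideal_in_path_point cdG2 _ q2I; right.
move/(congr1 ev): qE; rewrite {2}/ev mevalD -!/(ev _) q10 q20 /ev.
rewrite mevalB !mevalM !mevalXU !edge_indexK !path_pointE !eqxx.
rewrite (negPf a'a) (negPf d'd) /= mulr0 mulr1 sub0r addr0.
by move/eqP; rewrite oppr_eq0 oner_eq0.
Qed.
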